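(* For all integers $m,n\ge 1$, the independence polynomial $I_{T_{3,m,n}}(t)$ of the tree $T_{3,m,n}$ is unimodal.
   Context: For a finite simple graph $G$, let $i_k$ be the number of independent (stable) sets of $G$ of size $k$ ($i_0=1$), and $\alpha(G)$ the maximum size of an independent set. The independence polynomial is $I_G(t)=\sum_{k=0}^{\alpha(G)} i_k t^k$. A sequence $a_0,\dots,a_N$ is unimodal if there is $j$ with $a_0\le a_1\le\cdots\le a_j\ge a_{j+1}\ge\cdots\ge a_N$; a polynomial is unimodal if its coefficient sequence is. For nonnegative integers $m,n$, the tree $T_{3,m,n}$ has a root $v_0$ with three children $v_1,v_2,v_3$; $v_1$ has three children $v_{11},v_{12},v_{13}$, $v_2$ has $m$ children $v_{21},\dots,v_{2m}$, $v_3$ has $n$ children $v_{31},\dots,v_{3n}$, and each $v_{ij}$ has exactly one further child $v'_{ij}$ (a leaf). (Equivalently: $v_0$ joined to the centers of three spiders with $3$, $m$, $n$ legs of length $2$.) *)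

(* Defs.v *)
From mathcomp Require Import all_boot.
Set Implicit Arguments. Unset Strict Implicit. Unset Printing Implicit Defensive.

(* A simple graph on a finite vertex type T is given by an adjacency relation
   [adj : rel T] (symmetric and irreflexive for the trees below). *)
Section Indep.
Variables (T : finType) (adj : rel T).

Definition independent (S : {set T}) : bool :=
  [forall x in S, forall y in S, ~~ adj x y].

Definition indep_count (k : nat) : nat :=
  #|[set S : {set T} | independent S & #|S| == k]|.

Definition indep_number : nat := \max_(S : {set T} | independent S) #|S|.

Definition indep_poly_coefs : seq nat :=
  [seq indep_count k | k <- iota 0 indep_number.+1].
End Indep.

Definition unimodal (s : seq nat) : Prop :=
  exists j, (forall i, i < j -> i.+1 < size s -> nth 0 s i <= nth 0 s i.+1) /\
            (forall i, j <= i -> i.+1 < size s -> nth 0 s i.+1 <= nth 0 s i).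

(* Vertex set:  v0                          = inl (inl (inl (inl tt)))
                v1, v2, v3 (i = 0,1,2)      = inl (inl (inl (inr i)))
                v_{1j} / v'_{1j}  (j < 3)   = inl (inl (inr (j, false/true)))
                v_{2j} / v'_{2j}  (j < m)   = inl (inr (j, false/true))
                v_{3j} / v'_{3j}  (j < n)   = inr (j, false/true)        *)
Definition tvert (m n : nat) : finType :=
  ((((unit + 'I_3) + ('I_3 * bool)) + ('I_m * bool)) + ('I_n * bool))%type.

Definition c0 : 'I_3 := @Ordinal 3 0 isT.
Definition c1 : 'I_3 := @Ordinal 3 1 isT.
Definition c2 : 'I_3 := @Ordinal 3 2 isT.

Definition tparent (m n : nat) (x : tvert m n) : option (tvert m n) :=
  match x with
  | inl (inl (inl (inl _))) => None
  | inl (inl (inl (inr _))) => Some (inl (inl (inl (inl tt))))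
  | inl (inl (inr (j, false))) => Some (inl (inl (inl (inr c0))))
  | inl (inl (inr (j, true))) => Some (inl (inl (inr (j, false))))
  | inl (inr (j, false)) => Some (inl (inl (inl (inr c1))))
  | inl (inr (j, true)) => Some (inl (inr (j, false)))
  | inr (j, false) => Some (inl (inl (inl (inr c2))))
  | inr (j, true) => Some (inr (j, false))
  end.

Definition tadj (m n : nat) : rel (tvert m n) :=
  fun x y => (tparent x == Some y) || (tparent y == Some x).

(* Main.v *)
Require Import Defs.
From Stdlib Require Import NArith.
From mathcomp Require Import all_boot all_order all_algebra.
From mathcomp Require Import zify ring.
Import Order.TTheory GRing.Theory Num.Theory.
Set Implicit Arguments. Unset Strict Implicit. Unset Printing Implicit Defensive.

(** With a = 1 + 2t, b = 1 + t and N = l + m + n, conditioning on the states of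
    v0, v1, v2, v3 gives for the tree with l, m and n legs
      I = (a^l + t b^l) (a^m + t b^m) (a^n + t b^n) + t a^N,
    which is a^N plus eight terms t^d a^i b^j with 1 <= d <= 3 and i + j <= N.
    Because 2b = a + 1, each a^i b^j is an average of powers a^p with p <= N,
    so a linear inequality on coefficients need only be checked on t^d a^p, with
    an eighth of a^N to spare.  Since the coefficients of a^p are 2^k C(p, k),
    the first differences of I are nonpositive for 3k >= 2N + 11 and, when
    N >= 80, nonnegative for 3k <= 2N - 2, while the second differences are
    nonpositive in between.  For l = 3 this leaves finitely many pairs (m, n),
    which are settled by computation. *)

Local Open Scope ring_scope.

(** * Unimodal sequences *)

Section UnimodalFun.

Variables (disp : Order.disp_t) (T : orderType disp).
Implicit Type s : nat -> T.
Local Open Scope order_scope.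

Definition unimodal_fun s : Prop :=
  exists j, (forall i, (i < j)%N -> s i <= s i.+1) /\
            (forall i, (j <= i)%N -> s i.+1 <= s i).

Lemma unimodal_fun_persistent_descent s k0 k1 :
  (forall i, (i < k0)%N -> s i <= s i.+1) ->
  (forall i, (k0 <= i)%N -> s i.+1 <= s i -> s i.+2 <= s i.+1) ->
  (k0 <= k1)%N -> s k1.+1 <= s k1 ->
  unimodal_fun s.
Proof.
move=> ascent persistent k01 descent.
have exists_descent : exists i, (k0 <= i)%N && (s i.+1 <= s i).
  by exists k1; rewrite k01.
case: (ex_minnP exists_descent) => j /andP[k0j sj] j_min; exists j; split=> i ij.
  have [/ascent//|k0i] := ltnP i k0.
  by apply/ltW; rewrite ltNge; apply: contraL ij => si; rewrite -leqNgt j_min ?k0i.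
rewrite -(subnKC ij); elim: (i - j)%N => [|e IHe]; first by rewrite addn0.
by rewrite addnS; apply: persistent => //; lia.
Qed.

End UnimodalFun.

(** * Differences of coefficients *)

Definition coef_diff (r k : nat) (f : {poly int}) : int := ((1 - 'X) ^+ r * f)`_k.

Lemma coef_diffD r k : {morph coef_diff r k : f g / f + g}.
Proof. by move=> f g; rewrite /coef_diff mulrDr coefD. Qed.

Lemma coef_diffXnM r l k f :
  coef_diff r k ('X^l * f) = if (k < l)%N then 0 else coef_diff r (k - l) f.
Proof. by rewrite /coef_diff mulrCA coefXnM. Qed.

Lemma coef_diff_at0 r f : coef_diff r 0 f = f`_0.
Proof.
by rewrite /coef_diff -!horner_coef0 !(hornerE, horner_exp) ?subr0 expr1n mul1r.
Qed.

Lemma coef_diff0 k f : coef_diff 0 k f = f`_k.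
Proof. by rewrite /coef_diff mul1r. Qed.

Lemma coef_diffS r k f :
  coef_diff r.+1 k.+1 f = coef_diff r k.+1 f - coef_diff r k f.
Proof. by rewrite /coef_diff exprS -mulrA mulrBl mul1r coefB coefXM. Qed.

(** * Powers of the independence polynomial of an edge *)

Definition edge_poly : {poly int} := 1 + 'X *+ 2.
Definition vertex_poly : {poly int} := 1 + 'X.

Lemma coef_edge_exp p k : (edge_poly ^+ p)`_k = (2 ^ k * 'C(p, k))%N%:Z.
Proof.
have -> : edge_poly ^+ p = \poly_(i < p.+1) (2 ^ i * 'C(p, i))%N%:Z.
  rewrite poly_def exprDn; apply: eq_bigr => i _.
  by rewrite expr1n mul1r exprMn_n -mulrnA -scaler_nat natz.
by rewrite coef_poly; case: ltnP => // pk; rewrite bin_small // muln0.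
Qed.

Lemma coef_edge_exp_ge0 p k : 0 <= (edge_poly ^+ p)`_k.
Proof. by rewrite coef_edge_exp. Qed.

Lemma coef_edge_exp_small p k : (p < k)%N -> (edge_poly ^+ p)`_k = 0.
Proof. by move=> pk; rewrite coef_edge_exp bin_small // muln0. Qed.

Lemma coef_edge_expS p k :
  k.+1%:Z * (edge_poly ^+ p)`_k.+1 = 2 * (p%:Z - k%:Z) * (edge_poly ^+ p)`_k.
Proof.
have [kp|pk] := leqP k p; last first.
  by rewrite !coef_edge_exp_small ?mulr0 // leqW.
rewrite !coef_edge_exp expnS subzn // -!PoszM; congr Posz.
by rewrite -mulnA mulnCA [(k.+1 * _)%N]mulnCA mul_bin_left; lia.
Qed.

Lemma coef_edge_exp_homo p q k :
  (p <= q)%N -> (edge_poly ^+ p)`_k <= (edge_poly ^+ q)`_k.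
Proof. by move=> pq; rewrite !coef_edge_exp lez_nat leq_mul2l leq_bin2l ?orbT. Qed.

Lemma double_bin_leq q j : (q < j.*2)%N -> (2 * 'C(q, j) <= 'C(q.+1, j))%N.
Proof.
case: j => [|j] // qj; have [small|jq] := ltnP q j.+1; first by rewrite bin_small.
rewrite binS mul2n -addnn leq_add2l.
by rewrite -(leq_pmul2l (ltn0Sn j)) mul_bin_left leq_mul2r; lia.
Qed.

Lemma exp2_bin_leq p e j : (p + e <= j.*2)%N -> (2 ^ e * 'C(p, j) <= 'C(p + e, j))%N.
Proof.
elim: e => [|e IHe]; first by rewrite mul1n addn0.
rewrite addnS => pej; rewrite expnS -mulnA.
by rewrite (leq_trans _ (double_bin_leq pej)) // leq_mul2l IHe // ltnW.
Qed.

Lemma exp2_coef_edge_exp p q k : (p <= q <= k.*2)%N ->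
  (2 ^ (q - p))%N%:Z * (edge_poly ^+ p)`_k <= (edge_poly ^+ q)`_k.
Proof.
move=> /andP[pq qk]; rewrite !coef_edge_exp -PoszM lez_nat mulnCA leq_mul2l.
by have := @exp2_bin_leq p (q - p) k; rewrite subnKC // => ->; rewrite ?orbT.
Qed.

Lemma coef_diff1_edge_exp p k :
  k.+1%:Z * coef_diff 1 k.+1 (edge_poly ^+ p)
  = (2 * p%:Z - 3 * k%:Z - 1) * (edge_poly ^+ p)`_k.
Proof. by rewrite coef_diffS !coef_diff0 mulrBr coef_edge_expS; lia. Qed.

Lemma coef_diff2_edge_exp p k :
  k.+1%:Z * k.+2%:Z * coef_diff 2 k.+2 (edge_poly ^+ p)
  = ((2 * p%:Z - 3 * k.+1%:Z) ^+ 2 - 3 * k.+1%:Z - 4) * (edge_poly ^+ p)`_k.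
Proof.
rewrite !coef_diffS !coef_diff0; set f := edge_poly ^+ p.
have first_step := coef_edge_expS p k; have second_step := coef_edge_expS p k.+1.
rewrite -/f in first_step second_step.
transitivity (k.+1%:Z * (k.+2%:Z * f`_k.+2) - 2 * k.+2%:Z * (k.+1%:Z * f`_k.+1)
              + k.+1%:Z * k.+2%:Z * f`_k); first by ring.
rewrite second_step mulrCA first_step -[k.+2]addn1 -[k.+1]addn1 !PoszD; ring.
Qed.

Lemma coef_edge_exp_leq_mode p j k : (j <= k)%N -> (3 * k <= 2 * p + 2)%N ->
  (edge_poly ^+ p)`_j <= (edge_poly ^+ p)`_k.
Proof.
move=> jk; elim: k jk => [|k IHk]; first by rewrite leqn0 => /eqP->.
rewrite leq_eqVlt => /orP[/eqP-> //|jk] kp.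
apply: le_trans (IHk jk _) _; first by lia.
rewrite -(ler_pM2l (ltr0Sn _ k)) natz coef_edge_expS ler_wpM2r ?coef_edge_exp_ge0 //.
by lia.
Qed.

(** * Mixed powers and the polynomial of the tree *)

Lemma additive_edge_vertex_exp_le (L : {poly int} -> int) (B : int) N i j :
  {morph L : f g / f + g} ->
  (forall p, (p <= N)%N -> L (edge_poly ^+ p) <= B) -> (i + j <= N)%N ->
  L (edge_poly ^+ i * vertex_poly ^+ j) <= B.
Proof.
move=> LD edge_le; elim: j i => [|j IHj] i ijN.
  by rewrite mulr1 edge_le // -(addn0 i).
have average : L (edge_poly ^+ i * vertex_poly ^+ j.+1) *+ 2
    = L (edge_poly ^+ i.+1 * vertex_poly ^+ j) + L (edge_poly ^+ i * vertex_poly ^+ j).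
  by rewrite mulr2n -!LD; congr (L _); rewrite !exprS /edge_poly /vertex_poly; ring.
by have := IHj i.+1; have := IHj i; lia.
Qed.

Definition spider_poly (n : nat) : {poly int} :=
  edge_poly ^+ n + 'X * vertex_poly ^+ n.

Definition tree_poly (l m n : nat) : {poly int} :=
  spider_poly l * spider_poly m * spider_poly n + 'X * edge_poly ^+ (l + m + n).

Lemma tree_polyC l m n : tree_poly l m n = tree_poly l n m.
Proof. by rewrite /tree_poly mulrAC addnAC. Qed.

Lemma additive_tree_poly_le0 (L : {poly int} -> int) l m n (N := (l + m + n)%N) :
  {morph L : f g / f + g} ->
  (forall d p, (0 < d <= 3)%N -> (p <= N)%N ->
    L (edge_poly ^+ N) + 8 * L ('X^d * edge_poly ^+ p) <= 0) ->
  L (tree_poly l m n) <= 0.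
Proof.
move=> LD dominated.
have term_le d i j : (0 < d <= 3)%N -> (i + j <= N)%N ->
    8 * L ('X^d * (edge_poly ^+ i * vertex_poly ^+ j)) <= - L (edge_poly ^+ N).
  move=> d3; apply: (@additive_edge_vertex_exp_le (fun f => 8 * L ('X^d * f))).
    by move=> f g; rewrite mulrDr LD mulrDr.
  by move=> p pN; have := dominated d p d3 pN; lia.
have -> : tree_poly l m n = edge_poly ^+ N
  + 'X^1 * (edge_poly ^+ N * vertex_poly ^+ 0)
  + 'X^1 * (edge_poly ^+ (m + n) * vertex_poly ^+ l)
  + 'X^1 * (edge_poly ^+ (l + n) * vertex_poly ^+ m)
  + 'X^1 * (edge_poly ^+ (l + m) * vertex_poly ^+ n)
  + 'X^2 * (edge_poly ^+ n * vertex_poly ^+ (l + m))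
  + 'X^2 * (edge_poly ^+ m * vertex_poly ^+ (l + n))
  + 'X^2 * (edge_poly ^+ l * vertex_poly ^+ (m + n))
  + 'X^3 * (edge_poly ^+ 0 * vertex_poly ^+ N).
  by rewrite /tree_poly /spider_poly /N !exprD; ring.
rewrite !LD.
have := term_le 1%N N 0%N isT; have := term_le 1%N (m + n)%N l isT.
have := term_le 1%N (l + n)%N m isT; have := term_le 1%N (l + m)%N n isT.
have := term_le 2%N n (l + m)%N isT; have := term_le 2%N m (l + n)%N isT.
have := term_le 2%N l (m + n)%N isT; have := term_le 3%N 0%N N isT.
by rewrite /N; lia.
Qed.

(** * First differences away from the mode *)

Lemma coef_diff1_edge_exp_le0 p k :
  (2 * p + 2 <= 3 * k)%N -> coef_diff 1 k (edge_poly ^+ p) <= 0.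
Proof.
case: k => [|k] pk; first by lia.
rewrite -(pmulr_rle0 _ (ltr0Sn _ k)) natz coef_diff1_edge_exp.
by rewrite mulr_le0_ge0 ?coef_edge_exp_ge0 //; lia.
Qed.

Lemma coef_diff1_tree_poly_le0 l m n k (N := (l + m + n)%N) :
  (2 * N + 11 <= 3 * k)%N -> coef_diff 1 k (tree_poly l m n) <= 0.
Proof.
move=> Nk; apply: additive_tree_poly_le0; first exact: coef_diffD.
move=> d p /andP[_ d3]; rewrite -/N => pN.
have head_le0 : coef_diff 1 k (edge_poly ^+ N) <= 0.
  by apply: coef_diff1_edge_exp_le0; lia.
have shift_le0 : coef_diff 1 k ('X^d * edge_poly ^+ p) <= 0.
  by rewrite coef_diffXnM; case: ifP => // _; apply: coef_diff1_edge_exp_le0; lia.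
by lia.
Qed.

Lemma mul8_leq_exp2 e : (8 * e <= 2 ^ e + 28)%N.
Proof.
by case: e => [|[|[|[|[|e]]]]] //; elim: e => // e IHe; rewrite expnS; lia.
Qed.

(* For x = 3j + 1 - 2p > 0 the exponent e = (8 + x) / 2 satisfies p + e <= N and
   p + e <= 2j, and raising p to p + e gains the factor 2^e >= 4x. *)
Lemma coef_edge_exp_descent_le N p j :
  (9 <= j)%N -> (3 * j + 8 <= 2 * N)%N -> (p <= N)%N ->
  4 * (3 * j%:Z + 1 - 2 * p%:Z) * (edge_poly ^+ p)`_j <= (edge_poly ^+ N)`_j.
Proof.
move=> j9 jN pN; set x := 3 * j%:Z + 1 - 2 * p%:Z.
have [xle0|xgt0] := leP x 0.
  apply: le_trans (coef_edge_exp_ge0 N j).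
  by rewrite mulr_le0_ge0 ?coef_edge_exp_ge0 //; lia.
pose e := ((8 + (3 * j + 1 - 2 * p)) %/ 2)%N.
have gain := @exp2_coef_edge_exp p (p + e) j; rewrite addKn in gain.
have pe_le_N : (edge_poly ^+ (p + e))`_j <= (edge_poly ^+ N)`_j.
  by apply: coef_edge_exp_homo; rewrite /e; lia.
apply: le_trans pe_le_N; apply: le_trans (gain _); last by rewrite /e; lia.
rewrite ler_wpM2r ?coef_edge_exp_ge0 //.
by have := mul8_leq_exp2 e; rewrite /x /e; lia.
Qed.

(* Cross-multiplied estimate behind [coef_diff1_edge_exp_dominates]; there
   j = k - d - 1 is the index reached in the shifted power t^d a^p. *)
Lemma coef_edge_exp_descent_cross_le N p k j :
  (80 <= N)%N -> (3 * k + 2 <= 2 * N)%N -> (j.+2 <= k <= j + 4)%N -> (p <= N)%N ->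
  8 * k%:Z * (3 * j%:Z + 1 - 2 * p%:Z) * (edge_poly ^+ p)`_j
  <= j.+1%:Z * (2 * N%:Z + 2 - 3 * k%:Z) * (edge_poly ^+ N)`_j.
Proof.
move=> N80 kN /andP[jk kj] pN.
have coefN_ge0 := coef_edge_exp_ge0 N j; have coefp_ge0 := coef_edge_exp_ge0 p j.
have [pj|jp] := ltnP p j.
  by rewrite coef_edge_exp_small // mulr0 mulr_ge0 // mulr_ge0 //; lia.
have coef_pN := coef_edge_exp_homo j pN.
have [j9|j9] := ltnP j 9; last first.
  have descent := @coef_edge_exp_descent_le N p j j9 ltac:(lia) pN.
  apply: (@le_trans _ _ (2 * k%:Z * (edge_poly ^+ N)`_j)).
    by have := ler_wpM2l (_ : 0 <= 2 * k%:Z) descent; rewrite !mulrA; lia.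
  by rewrite ler_wpM2r //; nia.
have weight_le : 8 * k%:Z * (3 * j%:Z + 1 - 2 * p%:Z)
    <= j.+1%:Z * (2 * N%:Z + 2 - 3 * k%:Z) by nia.
apply: le_trans (ler_wpM2r coefp_ge0 weight_le) _.
by rewrite ler_wpM2l // mulr_ge0 //; lia.
Qed.

Lemma coef_diff1_edge_exp_dominates N p d k :
  (80 <= N)%N -> (3 * k + 2 <= 2 * N)%N -> (0 < d <= 3)%N -> (p <= N)%N ->
  0 <= coef_diff 1 k (edge_poly ^+ N) + 8 * coef_diff 1 k ('X^d * edge_poly ^+ p).
Proof.
move=> N80 kN /andP[d0 d3] pN; rewrite coef_diffXnM.
case: k kN => [|k] kN.
  by rewrite d0 mulr0 addr0 coef_diff_at0 coef_edge_exp_ge0.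
have headE := coef_diff1_edge_exp N k; have coefN_ge0 := coef_edge_exp_ge0 N k.
have head_ge0 : 0 <= coef_diff 1 k.+1 (edge_poly ^+ N).
  by rewrite -(pmulr_rge0 _ (ltr0Sn _ k)) natz headE mulr_ge0 //; lia.
case: ifP => [_|kd]; first by rewrite mulr0 addr0.
case kdE: (k.+1 - d)%N => [|j].
  by rewrite coef_diff_at0 addr_ge0 // mulr_ge0 ?coef_edge_exp_ge0.
have tailE := coef_diff1_edge_exp p j.
have cross_le := @coef_edge_exp_descent_cross_le N p k.+1 j N80 kN ltac:(lia) pN.
have jk : (edge_poly ^+ N)`_j <= (edge_poly ^+ N)`_k.
  by apply: coef_edge_exp_leq_mode; lia.
have slope_ge0 : 0 <= j.+1%:Z * (2 * N%:Z + 2 - 3 * k.+1%:Z).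
  by rewrite mulr_ge0 //; lia.
have weight_gt0 : 0 < k.+1%:Z * j.+1%:Z by rewrite mulr_gt0.
rewrite -(pmulr_rge0 _ weight_gt0).
set D := coef_diff 1 k.+1 _ in headE *; set E := coef_diff 1 j.+1 _ in tailE *.
have -> : k.+1%:Z * j.+1%:Z * (D + 8 * E)
    = j.+1%:Z * (k.+1%:Z * D) + 8 * k.+1%:Z * (j.+1%:Z * E) by ring.
rewrite headE tailE; have := ler_wpM2l slope_ge0 jk; lia.
Qed.

Lemma coef_diff1_tree_poly_ge0 l m n k (N := (l + m + n)%N) :
  (80 <= N)%N -> (3 * k + 2 <= 2 * N)%N -> 0 <= coef_diff 1 k (tree_poly l m n).
Proof.
move=> N80 kN; rewrite -oppr_le0.
apply: (@additive_tree_poly_le0 (fun f => - coef_diff 1 k f)) => [f g|d p d3 pN].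
  by rewrite coef_diffD opprD.
have := coef_diff1_edge_exp_dominates N80 kN d3 pN; rewrite /N /=; lia.
Qed.

(** * Second differences around the mode *)

Lemma coef_edge_exp_decay N j e : (49 <= j)%N -> (3 * (j + e) <= 2 * N + 7)%N ->
  (9 ^ e)%:Z * (edge_poly ^+ N)`_j <= (10 ^ e)%:Z * (edge_poly ^+ N)`_(j + e).
Proof.
move=> j49; elim: e => [|e IHe] jeN; first by rewrite addn0.
have {}IHe := IHe ltac:(lia); rewrite addnS !expnS !PoszM -!mulrA.
have ratio : 9 * (edge_poly ^+ N)`_(j + e) <= 10 * (edge_poly ^+ N)`_(j + e).+1.
  rewrite -(ler_pM2l (ltr0Sn _ (j + e))) natz [leRHS]mulrCA coef_edge_expS !mulrA.
  by rewrite ler_wpM2r ?coef_edge_exp_ge0 //; lia.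
apply: le_trans (ler_wpM2l _ IHe) _ => //; rewrite mulrCA [leRHS]mulrCA.
by rewrite ler_wpM2l.
Qed.

Lemma coef_edge_exp_decay3 N j k : (49 <= j)%N -> (3 * k <= 2 * N + 7)%N ->
  (j <= k <= j + 3)%N -> 729 * (edge_poly ^+ N)`_j <= 1000 * (edge_poly ^+ N)`_k.
Proof.
move=> j49 kN /andP[jk kj]; have coefj_ge0 := coef_edge_exp_ge0 N j.
have := @coef_edge_exp_decay N j (k - j); rewrite (subnKC jk) => /(_ j49 kN).
have : (k - j <= 3)%N by rewrite leq_subLR.
by move: (k - j)%N => e; case: e => [|[|[|[|e]]]] e_le3; lia.
Qed.

Lemma quadratic_leq_exp2 e : (4 * e * e + 28 * e <= 122 + 5 * 2 ^ e)%N.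
Proof.
case: e => [|[|[|[|e]]]] //; elim: e => [|e IHe] //.
have := ltn_expl e (isT : 1 < 2)%N; move: IHe; rewrite [(2 ^ e.+1.+4)%N]expnS.
by rewrite !expnS; nia.
Qed.

Lemma coef_diff2_edge_exp_le N p j : (80 <= N)%N -> (p <= N)%N ->
  (2 * N <= 3 * j.+1 + 10)%N -> (3 * j.+1 <= 2 * N + 7)%N ->
  j.+1%:Z * j.+2%:Z * coef_diff 2 j.+2 (edge_poly ^+ p) <= 5 * (edge_poly ^+ N)`_j.
Proof.
move=> N80 pN lower upper; rewrite coef_diff2_edge_exp.
have gain : (2 ^ (N - p))%:Z * (edge_poly ^+ p)`_j <= (edge_poly ^+ N)`_j.
  by apply: exp2_coef_edge_exp; lia.
suff quadratic_le : (2 * p%:Z - 3 * j.+1%:Z) ^+ 2 - 3 * j.+1%:Z - 4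
    <= 5 * (2 ^ (N - p))%:Z.
  by have := ler_wpM2r (coef_edge_exp_ge0 p j) quadratic_le; lia.
have := quadratic_leq_exp2 (N - p); set y := 2 * N%:Z - 3 * j.+1%:Z.
have -> : 2 * p%:Z - 3 * j.+1%:Z = y - 2 * (N - p)%:Z by rewrite /y; lia.
have -> : 3 * j.+1%:Z = 2 * N%:Z - y by rewrite /y; lia.
have y_ge : -7 <= y by rewrite /y; lia.
have y_le : y <= 10 by rewrite /y; lia.
have := mulr_ge0 (_ : 0 <= y + 7) (_ : 0 <= 10 - y) => /(_ ltac:(lia) ltac:(lia)).
move: (N - p)%N (2 ^ _)%N => e t; clearbody y; rewrite expr2.
by case: e => [|e]; nia.
Qed.

Lemma coef_diff2_edge_exp_le_mode N k : (80 <= N)%N ->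
  (2 * N <= 3 * k.+1 + 1)%N -> (3 * k.+1 <= 2 * N + 10)%N ->
  k.+1%:Z * k.+2%:Z * coef_diff 2 k.+2 (edge_poly ^+ N) <= - 74 * (edge_poly ^+ N)`_k.
Proof.
move=> N80 lower upper; rewrite coef_diff2_edge_exp.
rewrite ler_wpM2r ?coef_edge_exp_ge0 // expr2.
have [] : -10 <= 2 * N%:Z - 3 * k.+1%:Z /\ 2 * N%:Z - 3 * k.+1%:Z <= 1 by lia.
by nia.
Qed.

(* After clearing denominators a^N contributes at most -74 times its k-th
   coefficient, and the other term at most 8 * 5 * (8/7) * (1000/729) < 63 times. *)
Lemma coef_diff2_edge_exp_dominates N p d k : (80 <= N)%N ->
  (2 * N <= 3 * k.+1 + 1)%N -> (3 * k.+1 <= 2 * N + 10)%N ->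
  (0 < d <= 3)%N -> (p <= N)%N ->
  coef_diff 2 k.+2 (edge_poly ^+ N) + 8 * coef_diff 2 k.+2 ('X^d * edge_poly ^+ p) <= 0.
Proof.
move=> N80 lower upper /andP[d0 d3] pN.
have coefN_ge0 := coef_edge_exp_ge0 N k.
have weight_gt0 : 0 < k.+1%:Z * k.+2%:Z by rewrite mulr_gt0.
have head_le := coef_diff2_edge_exp_le_mode N80 lower upper.
have [j kE] : exists j, k = (j + d)%N by exists (k - d)%N; lia.
have -> : coef_diff 2 k.+2 ('X^d * edge_poly ^+ p) = coef_diff 2 j.+2 (edge_poly ^+ p).
  by rewrite coef_diffXnM ifF; [congr coef_diff|]; lia.
have tail_le := @coef_diff2_edge_exp_le N p j N80 pN ltac:(lia) ltac:(lia).
have decay : 729 * (edge_poly ^+ N)`_j <= 1000 * (edge_poly ^+ N)`_k.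
  by apply: coef_edge_exp_decay3; lia.
rewrite -(pmulr_rle0 _ weight_gt0) mulrDr mulrCA.
set E := coef_diff 2 j.+2 _ in tail_le *.
have [E_le0|E_gt0] := leP E 0.
  by have : k.+1%:Z * k.+2%:Z * E <= 0; [rewrite pmulr_rle0|lia].
have weight_le : 7 * (k.+1%:Z * k.+2%:Z) <= 8 * (j.+1%:Z * j.+2%:Z) by nia.
by have := ler_wpM2r (ltW E_gt0) weight_le; lia.
Qed.

Lemma coef_diff2_tree_poly_le0 l m n k (N := (l + m + n)%N) : (80 <= N)%N ->
  (2 * N <= 3 * k.+1 + 1)%N -> (3 * k.+1 <= 2 * N + 10)%N ->
  coef_diff 2 k.+2 (tree_poly l m n) <= 0.
Proof.
move=> N80 lower upper.
apply: additive_tree_poly_le0 => [|d p d3 pN]; first exact: coef_diffD.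
exact: coef_diff2_edge_exp_dominates.
Qed.

Lemma unimodal_tree_poly_large l m n :
  (80 <= l + m + n)%N -> unimodal_fun (fun k => (tree_poly l m n)`_k).
Proof.
set N := (l + m + n)%N => N80.
have coef_diff1E k : coef_diff 1 k.+1 (tree_poly l m n)
    = (tree_poly l m n)`_k.+1 - (tree_poly l m n)`_k.
  by rewrite coef_diffS !coef_diff0.
apply: (@unimodal_fun_persistent_descent _ _ _ ((2 * N - 2) %/ 3)%N (2 * N)%N).
- move=> i i_lt; rewrite -subr_ge0 -coef_diff1E.
  by apply: coef_diff1_tree_poly_ge0; rewrite -/N //; lia.
- move=> i i_ge; rewrite -subr_le0 -coef_diff1E => descent.
  rewrite -subr_le0 -coef_diff1E.
  have [tail|window] := leqP (2 * N + 11)%N (3 * i.+2).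
    exact: coef_diff1_tree_poly_le0.
  apply: le_trans descent; rewrite -subr_le0 -coef_diffS.
  by apply: coef_diff2_tree_poly_le0; rewrite -/N; lia.
- by lia.
- rewrite -subr_le0 -coef_diff1E.
  by apply: coef_diff1_tree_poly_le0; rewrite -/N; lia.
Qed.

(** * Coefficient lists in binary arithmetic *)

Section CoefficientLists.

Implicit Types (s t : seq N) (st : seq N * seq N).

Definition list_poly s : {poly int} := Poly [seq (N.to_nat x)%:Z | x <- s].

Fixpoint list_add s t : seq N :=
  match s, t with
  | x :: s', y :: t' => N.add x y :: list_add s' t'
  | [::], _ => t
  | _, [::] => s
  end.

Definition list_mul_vertex s := list_add s (0%num :: s).
Definition list_mul_edge s := list_add s (0%num :: list_add s s).

Definition list_mul_spider n s :=
  list_add (iter n list_mul_edge s) (0%num :: iter n list_mul_vertex s).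

(* A pair of lists (F a^n, G b^n) whose sum is the polynomial of T_{l,m,n}, so
   that passing from n to n + 1 costs only additions. *)
Definition list_row_start l m : seq N * seq N :=
  let s := list_mul_spider l (list_mul_spider m [:: 1%num]) in
  (list_add s (0%num :: iter (l + m) list_mul_edge [:: 1%num]), 0%num :: s).

Definition list_row_next st := (list_mul_edge st.1, list_mul_vertex st.2).

Fixpoint list_unimodal s : bool :=
  if s is x :: s' then
    if N.leb x (head 0%num s') then list_unimodal s'
    else sorted [rel y z | N.leb z y] s
  else true.

Definition list_rows_unimodal l M K : bool :=
  all (fun m => all (fun st => list_unimodal (list_add st.1 st.2))
                  (traject list_row_next (list_row_start l m) (K - m)))
      (iota 0 M).

Lemma coef_list_poly s i : (list_poly s)`_i = (N.to_nat (nth 0%num s i))%:Z.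
Proof.
rewrite coef_Poly; have [i_lt|i_ge] := ltnP i (size s).
  by rewrite (nth_map 0%num).
by rewrite !nth_default ?size_map.
Qed.

Lemma list_poly_add s t : list_poly (list_add s t) = list_poly s + list_poly t.
Proof.
apply/polyP=> i; rewrite coefD !coef_list_poly -PoszD; congr Posz.
elim: s t i => [|x s IHs] [|y t] [|i] //=; rewrite ?addn0 ?IHs //.
by rewrite N2Nat.inj_add.
Qed.

Lemma list_poly_shift s : list_poly (0%num :: s) = 'X * list_poly s.
Proof. by apply/polyP=> -[|i]; rewrite coefXM !coef_list_poly. Qed.

Lemma list_poly_one : list_poly [:: 1%num] = 1.
Proof. by apply/polyP=> -[|[|i]]; rewrite coef_list_poly coef1. Qed.

Lemma list_poly_mul_vertex s :
  list_poly (list_mul_vertex s) = list_poly s * vertex_poly.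
Proof. by rewrite list_poly_add list_poly_shift /vertex_poly; ring. Qed.

Lemma list_poly_mul_edge s :
  list_poly (list_mul_edge s) = list_poly s * edge_poly.
Proof. by rewrite list_poly_add list_poly_shift list_poly_add /edge_poly; ring. Qed.

Lemma list_poly_iter (f : seq N -> seq N) p n s :
  (forall t, list_poly (f t) = list_poly t * p) ->
  list_poly (iter n f s) = list_poly s * p ^+ n.
Proof. by move=> fE; elim: n => [|n IHn]; rewrite ?mulr1 //= fE IHn exprSr mulrA. Qed.

Lemma list_poly_mul_spider n s :
  list_poly (list_mul_spider n s) = list_poly s * spider_poly n.
Proof.
rewrite list_poly_add list_poly_shift (list_poly_iter _ _ list_poly_mul_edge).
by rewrite (list_poly_iter _ _ list_poly_mul_vertex) /spider_poly; ring.
Qed.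

Lemma iter_list_row_next n st :
  iter n list_row_next st = (iter n list_mul_edge st.1, iter n list_mul_vertex st.2).
Proof. by elim: n => [|n /= ->] //; case: st. Qed.

Lemma list_poly_row l m n (st := iter n list_row_next (list_row_start l m)) :
  list_poly (list_add st.1 st.2) = tree_poly l m n.
Proof.
rewrite /st iter_list_row_next list_poly_add (list_poly_iter _ _ list_poly_mul_edge).
rewrite (list_poly_iter _ _ list_poly_mul_vertex) list_poly_add !list_poly_shift.
rewrite (list_poly_iter _ _ list_poly_mul_edge) !list_poly_mul_spider.
by rewrite list_poly_one /tree_poly /spider_poly !exprD; ring.
Qed.

Lemma leb_to_nat (x y : N) : N.leb x y -> (N.to_nat x <= N.to_nat y)%N.
Proof. by move=> /N.leb_le; lia. Qed.

Lemma sorted_list_poly s : sorted [rel y z | N.leb z y] s ->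
  forall i, (list_poly s)`_i.+1 <= (list_poly s)`_i.
Proof.
move=> /(sortedP 0%num) s_sorted i; rewrite !coef_list_poly lez_nat.
have [i_lt|i_ge] := ltnP i.+1 (size s); first exact/leb_to_nat/s_sorted.
by rewrite nth_default.
Qed.

Lemma list_unimodalP s : list_unimodal s -> unimodal_fun (fun i => (list_poly s)`_i).
Proof.
elim: s => [|x s IHs].
  by exists 0%N; split=> // i _; rewrite !coef_list_poly !nth_nil.
rewrite [list_unimodal _]/=; case: ifP => [x_le|_].
  move=> /IHs[j [ascent descent]]; exists j.+1; split=> [[|i] ij|[//|i] ij].
  - by rewrite !coef_list_poly lez_nat /= nth0 leb_to_nat.
  - by have := ascent i ij; rewrite !coef_list_poly.
  - by have := descent i ij; rewrite !coef_list_poly.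
by move=> s_sorted; exists 0%N; split=> // i _; apply: sorted_list_poly.
Qed.

Lemma list_rows_unimodalP l M K m n : list_rows_unimodal l M K ->
  (m < M)%N -> (m + n < K)%N -> unimodal_fun (fun k => (tree_poly l m n)`_k).
Proof.
move=> /(all_nthP 0%N); rewrite size_iota => rows mM mnK.
have nKm : (n < K - m)%N by lia.
have /= := rows m mM; rewrite nth_iota // => /(all_nthP (list_row_start l m)).
rewrite size_traject => /(_ n nKm); rewrite nth_traject // => /list_unimodalP.
by rewrite list_poly_row.
Qed.

End CoefficientLists.

Lemma list_rows_unimodal_3 : list_rows_unimodal 3 39 77.
Proof. by vm_compute. Qed.

Lemma unimodal_tree_poly_3 m n : unimodal_fun (fun k => (tree_poly 3 m n)`_k).
Proof.
wlog mn : m n / (m <= n)%N.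
  by move=> ordered; case/orP: (leq_total m n) => /ordered //; rewrite tree_polyC.
have [large|small] := leqP 80 (3 + m + n)%N; first exact: unimodal_tree_poly_large.
by apply: (list_rows_unimodalP list_rows_unimodal_3); lia.
Qed.

(** * Independent sets of the tree *)

Definition weighted_indep_poly (T : finType) (adj : rel T)
    (w : {set T} -> {poly int}) : {poly int} :=
  \sum_(S | independent adj S) 'X^#|S| * w S.

Lemma coef_weighted_indep_poly1 (T : finType) (adj : rel T) k :
  (weighted_indep_poly adj (fun=> 1))`_k = (indep_count adj k)%:Z.
Proof.
rewrite coef_sum /indep_count -sum1dep_card -[RHS]natz natr_sum [RHS]big_mkcondr.
by apply: eq_bigr => S _; rewrite mulr1 coefXn eq_sym; case: eqP.
Qed.

Lemma independentP (T : finType) (adj : rel T) (S : {set T}) :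
  reflect {in S &, forall x y, ~~ adj x y} (independent adj S).
Proof.
apply: (iffP forall_inP) => [indep x y xS|indep x xS].
  exact: (forall_inP (indep x xS)).
by apply/forall_inP=> y; apply: indep.
Qed.

Section SumGraph.

Variables (T1 T2 : finType) (adj : rel (T1 + T2)).
Hypothesis adjC : symmetric adj.

Definition join_set (S1 : {set T1}) (S2 : {set T2}) : {set T1 + T2} :=
  [set x | match x with inl y => y \in S1 | inr z => z \in S2 end].

Definition nonadjacent (S1 : {set T1}) (S2 : {set T2}) : bool :=
  [forall x in S1, forall y in S2, ~~ adj (inl x) (inr y)].

Lemma nonadjacentP (S1 : {set T1}) (S2 : {set T2}) :
  reflect {in S1 & S2, forall x y, ~~ adj (inl x) (inr y)} (nonadjacent S1 S2).
Proof.
apply: (iffP forall_inP) => [apart x y xS|apart x xS].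
  exact: (forall_inP (apart x xS)).
by apply/forall_inP=> y; apply: apart.
Qed.

Lemma card_join_set (S1 : {set T1}) (S2 : {set T2}) :
  #|join_set S1 S2| = (#|S1| + #|S2|)%N.
Proof.
rewrite -!sum1_card big_mkcond big_sumType /=.
by congr addn; rewrite [RHS]big_mkcond; apply: eq_bigr => x _; rewrite inE.
Qed.

Lemma sum_join_set (V : nmodType) (F : {set T1 + T2} -> V) :
  \sum_S F S = \sum_S1 \sum_S2 F (join_set S1 S2).
Proof.
rewrite pair_bigA /= (reindex (fun S => join_set S.1 S.2)) //=.
exists (fun S : {set T1 + T2} => (inl @^-1: S, inr @^-1: S)) => [[S1 S2]|S] _ /=.
  by congr pair; apply/setP=> x; rewrite !inE.
by apply/setP=> -[x|x]; rewrite !inE.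
Qed.

Lemma independent_join_set (S1 : {set T1}) (S2 : {set T2}) :
  independent adj (join_set S1 S2)
  = [&& independent (relpre inl adj) S1, independent (relpre inr adj) S2
      & nonadjacent S1 S2].
Proof.
apply/independentP/and3P => [indep|].
  by split; [apply/independentP|apply/independentP|apply/nonadjacentP] => x y xS yS;
    apply: indep; rewrite inE.
move=> [/independentP indep1 /independentP indep2 /nonadjacentP apart].
move=> [x|x] [y|y]; rewrite !inE => xS yS.
- exact: indep1.
- exact: apart.
- by rewrite adjC; apply: apart.
- exact: indep2.
Qed.

Lemma weighted_indep_poly_sum (w : {set T1 + T2} -> {poly int}) :
  weighted_indep_poly adj w
  = weighted_indep_poly (relpre inl adj) (fun S1 =>
      \sum_(S2 | independent (relpre inr adj) S2 && nonadjacent S1 S2)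
        'X^#|S2| * w (join_set S1 S2)).
Proof.
rewrite /weighted_indep_poly big_mkcond sum_join_set [RHS]big_mkcond.
apply: eq_bigr => S1 _; rewrite -big_mkcond /=.
under eq_bigl => S2 do rewrite independent_join_set.
case: (independent _ S1); last by rewrite big_pred0.
by rewrite mulr_sumr; apply: eq_bigr => S2 _; rewrite card_join_set exprD mulrA.
Qed.

End SumGraph.

Definition legs_poly (k : nat) (c : bool) : {poly int} :=
  (if c then vertex_poly else edge_poly) ^+ k.

Section Legs.

Variable J : finType.

(* [c] tells whether the vertex carrying the legs is selected. *)
Definition legs_independent (c : bool) (L : {set J * bool}) : bool :=
  [forall j, ~~ (((j, false) \in L) && (c || ((j, true) \in L)))].

Definition leg_set (f : {ffun J -> bool * bool}) : {set J * bool} :=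
  [set x | if x.2 then (f x.1).2 else (f x.1).1].

Lemma leg_set_bij : bijective leg_set.
Proof.
pose states (L : {set J * bool}) := [ffun j => ((j, false) \in L, (j, true) \in L)].
exists states => [f|L].
  by apply/ffunP=> j; rewrite ffunE !inE /=; case: (f j).
by apply/setP=> -[j []]; rewrite !inE ffunE.
Qed.

Lemma card_leg_set f : #|leg_set f| = (\sum_j ((f j).1 + (f j).2))%N.
Proof.
transitivity (\sum_j \sum_b ((j, b) \in leg_set f : nat))%N.
  rewrite pair_bigA /= -sum1_card big_mkcond.
  by apply: eq_bigr => -[j b] _; case: ifP.
by apply: eq_bigr => j _; rewrite big_bool !inE addnC.
Qed.

Lemma sum_legs_independent c :
  \sum_(L | legs_independent c L) 'X^#|L| = legs_poly #|J| c.
Proof.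
pose leg_weight (u : bool * bool) : {poly int} :=
  if u.1 && (c || u.2) then 0 else 'X^(u.1 + u.2).
have leg_weight_sum : \sum_u leg_weight u = if c then vertex_poly else edge_poly.
  rewrite -(pair_bigA _ (fun x y => leg_weight (x, y))) /= !big_bool /leg_weight /=.
  by case: (c); rewrite /edge_poly /vertex_poly /= ?expr0 ?expr1; ring.
rewrite /legs_poly -leg_weight_sum -prodr_const bigA_distr_bigA big_mkcond /=.
rewrite (reindex leg_set) /=; last exact/onW_bij/leg_set_bij.
apply: eq_bigr => f _; case: ifP => [/forallP indep|/forallPn[j]].
  rewrite card_leg_set expr_sum; apply: eq_bigr => j _.
  by have := indep j; rewrite !inE /leg_weight /= => /negbTE ->.
rewrite negbK !inE /= => adjacent.
by rewrite (bigD1 j) //= /leg_weight adjacent mul0r.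
Qed.

Variables (T : finType) (adj : rel (T + J * bool)) (c : T).
Variables (w : {set T + J * bool} -> {poly int}) (v : {set T} -> {poly int}).
Hypothesis adjC : symmetric adj.
Hypothesis adj_carrier : forall x j b, adj (inl x) (inr (j, b)) = (x == c) && ~~ b.
Hypothesis adj_leg :
  forall j b j' b', adj (inr (j, b)) (inr (j', b')) = (j == j') && (b != b').
Hypothesis w_join_set : forall S L, w (join_set S L) = v S.

Lemma independent_legs S L :
  independent (relpre inr adj) L && nonadjacent adj S L
  = legs_independent (c \in S) L.
Proof.
apply/andP/forallP => [[/independentP indep /nonadjacentP apart] j|legs].
  apply/negP=> /andP[inner /orP[cS|outer]].
    by have := apart c (j, false) cS inner; rewrite adj_carrier eqxx.
  by have := indep (j, false) (j, true) inner outer; rewrite /= adj_leg eqxx.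
split.
  apply/independentP=> -[j b] [j' b'] /= jL jL'; rewrite adj_leg; apply/negP.
  case/andP=> /eqP jj' bb'; have := legs j; rewrite -{}jj' in jL'.
  by case: b b' bb' jL jL' => [] [] // _ -> ->; rewrite orbT.
apply/nonadjacentP=> x [j b] xS jL; rewrite adj_carrier.
apply/negP=> /andP[/eqP xc nb].
by have := legs j; rewrite -xc xS -(negbTE nb) jL.
Qed.

Lemma weighted_indep_poly_legs :
  weighted_indep_poly adj w
  = weighted_indep_poly (relpre inl adj) (fun S => legs_poly #|J| (c \in S) * v S).
Proof.
rewrite weighted_indep_poly_sum //; apply: eq_bigr => S _; congr (_ * _).
rewrite -sum_legs_independent mulr_suml; apply: eq_big => [L|L _].
  exact: independent_legs.
by rewrite w_join_set.
Qed.

End Legs.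

Lemma sum_set_unit (V : nmodType) (F : {set unit} -> V) :
  \sum_E F E = F set0 + F setT.
Proof.
have setT_neq0 : setT != set0 :> {set unit} by apply/set0Pn; exists tt; rewrite inE.
rewrite (bigD1 set0) //= (bigD1 setT) //= big1 ?addr0 // => E /andP[/set0Pn[[] ttE]].
by case/eqP; apply/setP=> -[]; rewrite inE.
Qed.

Lemma sum_set_prod (R : comNzRingType) (I : finType) (x : R) (g : I -> bool -> R) :
  \sum_(S : {set I}) x ^+ #|S| * \prod_i g i (i \in S)
  = \prod_i (g i false + x * g i true).
Proof.
under [RHS]eq_bigr do rewrite addrC.
rewrite bigA_distr /=; apply: eq_bigr => S _.
rewrite -prodr_const big_mkcond -big_split /=; apply: eq_bigr => i _.
by case: (i \in S); rewrite ?mul1r.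
Qed.

Lemma weighted_indep_poly_star (I : finType) (adj : rel (unit + I))
    (g : I -> bool -> {poly int}) :
  symmetric adj -> ~~ adj (inl tt) (inl tt) ->
  (forall i, adj (inl tt) (inr i)) -> (forall i j, ~~ adj (inr i) (inr j)) ->
  weighted_indep_poly adj (fun S => \prod_i g i (inr i \in S))
  = \prod_i (g i false + 'X * g i true) + 'X * \prod_i g i false.
Proof.
move=> adjC adj_root adj_child adj_children.
have indep_root E : independent (relpre inl adj) E by apply/independentP=> -[] [].
have indep_children S : independent (relpre inr adj) S.
  by apply/independentP=> i j _ _; apply: adj_children.
have nonadjacent0 S : nonadjacent adj set0 S by apply/nonadjacentP=> x y; rewrite inE.
have nonadjacentT S : nonadjacent adj setT S = (S == set0).
  apply/nonadjacentP/eqP => [apart|-> x y _]; last by rewrite inE.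
  apply/setP=> i; rewrite inE; apply/negP=> /(apart tt i (in_setT _)).
  by rewrite adj_child.
rewrite weighted_indep_poly_sum // /weighted_indep_poly.
under [LHS]eq_bigl => E do rewrite indep_root.
rewrite sum_set_unit cards0 cardsT card_unit expr0 expr1 mul1r; congr (_ + _ * _).
  rewrite -sum_set_prod; apply: eq_big => S.
    by rewrite indep_children nonadjacent0.
  by move=> _; congr (_ * _); apply: eq_bigr => i _; rewrite inE.
under [LHS]eq_bigl => S do rewrite indep_children nonadjacentT.
rewrite big_pred1_eq cards0 expr0 mul1r; apply: eq_bigr => i _.
by rewrite !inE.
Qed.

Lemma tadj_sym m n : symmetric (@tadj m n).
Proof. by move=> x y; rewrite /tadj orbC. Qed.

Local Notation vertex_eqE :=
  (inj_eq Some_inj, inj_eq inr_inj, inj_eq inl_inj, xpair_eqE, andbF, andbT, orbF).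

Lemma weighted_indep_poly_tadj_legs3 m n :
  weighted_indep_poly (@tadj m n) (fun=> 1)
  = weighted_indep_poly (relpre inl (@tadj m n))
      (fun S => legs_poly n (inl (inl (inr c2)) \in S)).
Proof.
rewrite (weighted_indep_poly_legs (c := inl (inl (inr c2))) (v := fun=> 1)) //.
- by apply: eq_bigr => S _; rewrite card_ord mulr1.
- exact: tadj_sym.
- by move=> [[[[]|i]|[j []]]|[j []]] j' []; rewrite ?andbF ?andbT.
- by move=> j [] j' []; rewrite /tadj /= ?vertex_eqE.
Qed.

Lemma weighted_indep_poly_tadj_legs2 m n :
  weighted_indep_poly (relpre inl (@tadj m n))
    (fun S => legs_poly n (inl (inl (inr c2)) \in S))
  = weighted_indep_poly (relpre (inl \o inl) (@tadj m n))
      (fun S => legs_poly m (inl (inr c1) \in S) * legs_poly n (inl (inr c2) \in S)).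
Proof.
rewrite (weighted_indep_poly_legs (c := inl (inr c1))
           (v := fun S => legs_poly n (inl (inr c2) \in S))).
- by apply: eq_bigr => S _; rewrite card_ord.
- by move=> x y; apply: tadj_sym.
- by move=> [[[]|i]|[j []]] j' []; rewrite ?andbF ?andbT.
- by move=> j [] j' []; rewrite /tadj /= ?vertex_eqE.
- by move=> S L; rewrite inE.
Qed.

Lemma weighted_indep_poly_tadj_legs1 m n :
  weighted_indep_poly (relpre (inl \o inl) (@tadj m n))
    (fun S => legs_poly m (inl (inr c1) \in S) * legs_poly n (inl (inr c2) \in S))
  = weighted_indep_poly (relpre (inl \o inl \o inl) (@tadj m n))
      (fun S => legs_poly 3 (inr c0 \in S)
                * (legs_poly m (inr c1 \in S) * legs_poly n (inr c2 \in S))).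
Proof.
rewrite (weighted_indep_poly_legs (c := inr c0)
           (v := fun S => legs_poly m (inr c1 \in S) * legs_poly n (inr c2 \in S))).
- by apply: eq_bigr => S _; rewrite card_ord.
- by move=> x y; apply: tadj_sym.
- by move=> [[]|i] j' []; rewrite ?andbF ?andbT.
- by move=> j [] j' []; rewrite /tadj /= ?vertex_eqE.
- by move=> S L; rewrite !inE.
Qed.

Lemma weighted_indep_poly_tadj m n :
  weighted_indep_poly (@tadj m n) (fun=> 1) = tree_poly 3 m n.
Proof.
rewrite weighted_indep_poly_tadj_legs3 weighted_indep_poly_tadj_legs2.
rewrite weighted_indep_poly_tadj_legs1.
pose g (i : 'I_3) := legs_poly (nth 0 [:: 3; m; n] i)%N.
have g_prod (F : 'I_3 -> {poly int}) : \prod_i F i = F c0 * (F c1 * F c2).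
  rewrite !big_ord_recl big_ord0 mulr1.
  by congr (F _ * (F _ * F _)); apply: val_inj.
transitivity (weighted_indep_poly (relpre (inl \o inl \o inl) (@tadj m n))
                (fun S => \prod_i g i (inr i \in S))).
  by apply: eq_bigr => S _; rewrite g_prod.
rewrite weighted_indep_poly_star //; last by move=> x y; apply: tadj_sym.
by rewrite !g_prod /g /legs_poly /= /tree_poly /spider_poly !exprD; ring.
Qed.

Local Close Scope ring_scope.
Unset Implicit Arguments.

Theorem mainTheorem1 (m n : nat) (hm : 1 <= m) (hn : 1 <= n) :
  unimodal (indep_poly_coefs (@tadj m n)).
Proof.
have [j [ascent descent]] := unimodal_tree_poly_3 m n; exists j.
have coefE i : i < size (indep_poly_coefs (@tadj m n)) ->
    Posz (nth 0 (indep_poly_coefs (@tadj m n)) i) = ((tree_poly 3 m n)`_i)%R.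
  rewrite -weighted_indep_poly_tadj coef_weighted_indep_poly1.
  rewrite size_map size_iota => iN.
  by rewrite (nth_map 0) ?size_iota // nth_iota.
split=> i ij iN; rewrite -lez_nat !coefE ?(ltnW iN) //; first exact: ascent.
exact: descent.
Qed.
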